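(* Let $D$ be a weighted oriented graph. If $C$ is a minimal vertex cover of $D$, then $C$ is a strong vertex cover of $D$.
   Context: A weighted oriented graph is a triplet $D=(V(D),E(D),w)$ where $V=V(D)$ is a finite set, $E=E(D)\subseteq V\times V$ is the edge set of an oriented graph (no loops, and for $x\neq y$ at most one of $(x,y),(y,x)$ is in $E$), and $w:V\to\mathbb{N}=\{1,2,\dots\}$ is the weight function. Put $V^{+}=\{x\in V: w(x)\neq 1\}$. For $x\in V$: $N_D^{+}(x)=\{y:(x,y)\in E\}$, $N_D^{-}(x)=\{y:(y,x)\in E\}$, $N_D(x)=N_D^+(x)\cup N_D^-(x)$. A vertex cover of $D$ is a subset $C\subseteq V$ such that for every $(x,y)\in E$, $x\in C$ or $y\in C$. It is minimal if no proper subset of $C$ is a vertex cover of $D$. For a vertex cover $C$, with $C^c=V\setminus C$, define $L_1(C)=\{x\in C: N_D^{+}(x)\cap C^c\neq\emptyset\}$, $L_2(C)=\{x\in C: x\notin L_1(C)\text{ and }N_D^{-}(x)\cap C^c\neq\emptyset\}$, $L_3(C)=C\setminus(L_1(C)\cup L_2(C))$. A vertex cover $C$ is strong if for each $x\in L_3(C)$ there is $(y,x)\in E$ such that $y\in L_2(C)\cup L_3(C)$ and $y\in V^{+}$. *)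

(* Defs.v *)
From mathcomp Require Import all_boot.

Set Implicit Arguments.
Unset Strict Implicit.
Unset Printing Implicit Defensive.

Record wograph (V : finType) := WOGraph {
  edge : rel V;
  weight : V -> nat;
  edge_irr : forall x, ~~ edge x x;
  edge_oriented : forall x y, x != y -> ~~ (edge x y && edge y x);
  weight_gt0 : forall x, 0 < weight x
}.

Section WeightedOrientedGraphs.

Variables (V : finType) (D : wograph V).
Implicit Types (x y : V) (C : {set V}).

Definition Vplus : {set V} := [set x | weight D x != 1].

Definition outN x : {set V} := [set y | edge D x y].
Definition inN x : {set V} := [set y | edge D y x].

Definition vertex_cover C : Prop :=
  forall x y, edge D x y -> x \in C \/ y \in C.

Definition minimal_vertex_cover C : Prop :=
  vertex_cover C /\ forall C', C' \proper C -> ~ vertex_cover C'.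

Definition L1 C : {set V} := [set x in C | outN x :&: ~: C != set0].
Definition L2 C : {set V} :=
  [set x in C | (x \notin L1 C) && (inN x :&: ~: C != set0)].
Definition L3 C : {set V} := C :\: (L1 C :|: L2 C).

Definition strong_vertex_cover C : Prop :=
  vertex_cover C /\
  forall x, x \in L3 C ->
    exists y, [/\ edge D y x, y \in L2 C :|: L3 C & y \in Vplus].

End WeightedOrientedGraphs.

(* Main.v *)
(** If all neighbours of a vertex [x] of a cover [C] lie in [C], then [C :\ x]
    is still a cover.  Hence [L3 C] is empty when [C] is minimal, and the
    strongness condition is vacuous. *)

Require Import Defs.
From mathcomp Require Import all_boot.

Set Implicit Arguments.
Unset Strict Implicit.
Unset Printing Implicit Defensive.

(** A vertex of [C] lying in neither [L1 C] nor [L2 C] has no out-neighbour and no in-neighbour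
    outside [C], so every edge at it is already covered by its other end. Removing the vertex would
    then contradict minimality. *)

Lemma L3_neighbours (V : finType) (D : wograph V) (C : {set V}) x y :
  x \in L3 D C -> edge D x y || edge D y x -> y \in C.
Proof.
rewrite !inE; case: (x \in C); rewrite ?andbF //= andbT negb_or.
(* [L2] itself requires avoiding [L1]; rewriting with [nL1] reduces [nL2] to the condition on
   in-neighbours. *)
case/andP=> /[dup] nL1 -> /= nL2 xy; apply: contraT => yC.
case/orP: xy => e.
- by case/negP: nL1; apply/set0Pn; exists y; rewrite !inE e.
- by case/negP: nL2; apply/set0Pn; exists y; rewrite !inE e.
Qed.

Lemma L3_minimal_vertex_cover (V : finType) (D : wograph V) (C : {set V}) :
  minimal_vertex_cover D C -> L3 D C = set0.
Proof.
case=> coverC minC; apply/eqP/set0Pn=> -[x xL3].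
have xC : x \in C by case/setDP: xL3.
apply: (minC (C :\ x)); first exact: properD1.
move=> a b ab; rewrite !in_setD1.
have [ax | _] := eqVneq a x.
  right; subst a; rewrite (L3_neighbours xL3) ?ab // andbT.
  (* The other end [b] survives the removal of [x], since [b = x] would make the edge a loop. *)
  by apply: contraTneq ab => ->; exact: edge_irr.
have [bx | _] := eqVneq b x; last exact: coverC.
by left; subst b; rewrite (L3_neighbours xL3) ?ab ?orbT.
Qed.

Theorem corollary2p8 (V : finType) (D : wograph V) (C : {set V}) :
  minimal_vertex_cover D C -> strong_vertex_cover D C.
Proof.
move=> minC; split; first by case: minC.
by move=> x; rewrite L3_minimal_vertex_cover // inE.
Qed.
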